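(* Let $C:f=0$ be a reduced curve in $\mathbb{P}^2$ and let $L$ be a line in $\mathbb{P}^2$ which is not an irreducible component of $C$. Assume that the union $C'=C\cup L:f'=0$ is a free curve. Then $C$ is either a free curve or a plus-one generated curve.
   Context: Let $S=\mathbb{C}[x,y,z]$. For a reduced homogeneous polynomial $f\in S$ of degree $d$ defining a plane curve $C:f=0$ (the paper works with reduced curves of degree $d\ge 3$), let $D_0(f)=\{(a,b,c)\in S^3 : af_x+bf_y+cf_z=0\}$ be the graded $S$-module of Jacobian syzygies. If $D_0(f)$ is minimally generated by $m$ homogeneous elements, of degrees $d_1\le d_2\le\dots\le d_m$ (these are independent of the choice of minimal generators), the degrees $(d_1,\dots,d_m)$ are called the exponents of $C$. The curve $C$ is free if $m=2$ (i.e. $D_0(f)$ is a free $S$-module of rank 2), and $C$ is plus-one generated if $m=3$ and $d_1+d_2=d$. *)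

(* Defs.v *)
From HB Require Import structures.
From mathcomp Require Import all_boot all_order all_algebra.
From mathcomp Require Import complex.
From mathcomp Require Import Rstruct.
From mathcomp Require Import mpoly.

Set Implicit Arguments. Unset Strict Implicit. Unset Printing Implicit Defensive.
Import GRing.Theory.
Local Open Scope ring_scope.

Definition CC : numClosedFieldType := (complex Rdefinitions.R).

Notation S := {mpoly CC[3]}.

Definition ix : 'I_3 := @Ordinal 3 0 isT.
Definition iy : 'I_3 := @Ordinal 3 1 isT.
Definition iz : 'I_3 := @Ordinal 3 2 isT.

Definition homog_of_deg (f : S) (d : nat) : Prop :=
  f != 0 /\ f \is d.-homog.

Definition reduced (f : S) : Prop :=
  f != 0 /\ forall g q : S, f = g * g * q -> (msize g <= 1)%N.

Definition jac_syz (f : S) (s : S * S * S) : Prop :=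
  s.1.1 * mderiv ix f + s.1.2 * mderiv iy f + s.2 * mderiv iz f = 0.

Definition hom_syz (f : S) (ks : nat * (S * S * S)) : Prop :=
  let: (k, s) := ks in
  [/\ s.1.1 \is k.-homog, s.1.2 \is k.-homog, s.2 \is k.-homog & jac_syz f s].

Definition generates (f : S) (gens : seq (nat * (S * S * S))) : Prop :=
  (forall ks, ks \in gens -> hom_syz f ks) /\
  forall s, jac_syz f s ->
    exists cs : seq S, size cs = size gens /\
      [/\ s.1.1 = \sum_(i < size gens) cs`_i * (nth (0%N, (0, 0, 0)) gens i).2.1.1,
          s.1.2 = \sum_(i < size gens) cs`_i * (nth (0%N, (0, 0, 0)) gens i).2.1.2
        & s.2   = \sum_(i < size gens) cs`_i * (nth (0%N, (0, 0, 0)) gens i).2.2].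

Definition minimal_generators (f : S) (gens : seq (nat * (S * S * S))) : Prop :=
  generates f gens /\
  forall gens', generates f gens' -> (size gens <= size gens')%N.

Definition exponents (f : S) (ds : seq nat) : Prop :=
  exists gens, minimal_generators f gens /\ map fst gens = ds /\ sorted leq ds.

Definition free_curve (f : S) : Prop :=
  exists ds, exponents f ds /\ size ds = 2%N.

Definition plus_one_generated (f : S) (d : nat) : Prop :=
  exists d1 d2 d3, exponents f [:: d1; d2; d3] /\ (d1 + d2)%N = d.

(* Main.v *)
(* Let S = C[x,y,z] and let u, v be a basis of D_0(f l).  Adding multiples of
   the Euler derivation to u and v gives syzygies s, t of f with the same
   degrees e1, e2, and s, t form a basis of the submodule of those w in D_0(f)
   for which w(l) is divisible by l; this submodule contains l D_0(f).

   The cross product of u and v is a multiple h of the gradient of f l, because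
   S is factorial and the partial derivatives of the squarefree f l have no
   common factor.  As the Koszul syzygies are combinations of u and v, h divides
   every partial derivative, so h is constant and e1 + e2 = d.

   On the line l = 0 both s and t are tangent to the line and annihilate the
   restriction of f, so their restrictions are parallel.  If both vanish, s/l
   and t/l form a basis of D_0(f).  Otherwise the relations between them are
   generated by one coprime pair, Q s - P t = 0 mod l, and D_0(f) is generated by
   s, t and r = (Q s - P t)/l.  If P or Q is constant then two of these suffice.
   If neither is, the only relation l r = Q s - P t has coefficients without
   constant term, so the three generators are minimal, and comparing degrees
   in this relation gives deg r >= e1, e2. *)
Require Import Defs.
From HB Require Import structures.
From mathcomp Require Import all_boot all_order all_algebra.
From mathcomp Require Import complex Rstruct mpoly ring zify.
From Stdlib Require Import Classical.

Set Implicit Arguments. Unset Strict Implicit. Unset Printing Implicit Defensive.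
Import GRing.Theory Num.Theory.
Local Open Scope ring_scope.

(** * Factorial domains and Gauss's lemma *)

Section Divisibility.
Variable R : idomainType.
Implicit Types (a b c p u : R) (s : seq R).

Definition divides a b := exists c, b = c * a.

Definition prime_elt p :=
  [/\ p != 0, ~ divides p 1
    & forall a b, divides p (a * b) -> divides p a \/ divides p b].

Definition prime_seq s := forall p, p \in s -> prime_elt p.

Definition factors a :=
  exists u s, [/\ divides u 1, prime_seq s & a = u * \prod_(p <- s) p].

Definition factorial := forall a, a != 0 -> factors a.

(** For a nonzero family in a factorial domain this means gcd 1. *)
Definition primitive (I : Type) (F : I -> R) :=
  forall p, prime_elt p -> exists i, ~ divides p (F i).

Lemma divides0 a : divides a 0.
Proof. by exists 0; rewrite mul0r. Qed.

Lemma dividesMl a b c : divides a b -> divides a (c * b).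
Proof. by case=> d ->; exists (c * d); rewrite mulrA. Qed.

Lemma dividesMr a b c : divides a b -> divides a (b * c).
Proof. by rewrite mulrC; apply: dividesMl. Qed.

Lemma divides_trans b a c : divides a b -> divides b c -> divides a c.
Proof. by move=> dab [d ->]; apply: dividesMl. Qed.

Lemma dividesD a b c : divides a b -> divides a c -> divides a (b + c).
Proof. by move=> [d ->] [e ->]; exists (d + e); rewrite mulrDl. Qed.

Lemma dividesB a b c : divides a b -> divides a c -> divides a (b - c).
Proof. by move=> [d ->] [e ->]; exists (d - e); rewrite mulrBl. Qed.

Lemma unit_neq0 u : divides u 1 -> u != 0.
Proof.
case=> c uc; apply/eqP => u0; move/eqP: uc.
by rewrite u0 mulr0 oner_eq0.
Qed.

Lemma divides_unit u a : divides u 1 -> divides u a.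
Proof. by move=> /(dividesMl a); rewrite mulr1. Qed.

Lemma unitM u v : divides u 1 -> divides v 1 -> divides (u * v) 1.
Proof. by move=> [c cu] [d dv]; exists (c * d); rewrite mulrACA -cu -dv mulr1. Qed.

Lemma prime_seq_cons p s : prime_seq (p :: s) <-> prime_elt p /\ prime_seq s.
Proof.
split=> [ps|[pp ps] q].
  by split=> [|q qs]; apply: ps; rewrite inE ?eqxx ?qs ?orbT.
by rewrite inE => /orP[/eqP->|/ps].
Qed.

Lemma prime_divides_prod p s :
  prime_elt p -> divides p (\prod_(q <- s) q) -> exists2 q, q \in s & divides p q.
Proof.
move=> [_ pn1 pM]; elim: s => [|q s IHs]; first by rewrite big_nil.
rewrite big_cons => /pM[dpq|/IHs[r rs dpr]].
  by exists q => //; rewrite inE eqxx.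
by exists r => //; rewrite inE rs orbT.
Qed.

(** The two primes are associates: in q = c p, if q divided c, cancelling q would make p a unit. *)
Lemma prime_divides_prime p q : prime_elt p -> prime_elt q -> divides p q ->
  divides q p.
Proof.
move=> [p0 pn1 _] [q0 _ qM] [c qE].
have /qM[[d cE]|//] : divides q (c * p) by rewrite -qE; exists 1; rewrite mul1r.
case: pn1; exists d; apply: (mulfI q0); rewrite mulr1 {1}qE cE; ring.
Qed.

Lemma factorsM a b : factors a -> factors b -> factors (a * b).
Proof.
move=> [u [s [u1 ps ->]]] [v [t [v1 pt ->]]].
exists (u * v), (s ++ t); split; first exact: unitM.
  by move=> p; rewrite mem_cat => /orP[/ps|/pt].
by rewrite big_cat /= mulrACA.
Qed.

Lemma factors_unit u : divides u 1 -> factors u.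
Proof. by move=> u1; exists u, [::]; split=> //; rewrite big_nil mulr1. Qed.

Lemma factors_prime p : prime_elt p -> factors p.
Proof.
move=> pp; exists 1, [:: p]; split; first by exists 1; rewrite mulr1.
  by move=> q; rewrite inE => /eqP->.
by rewrite big_seq1 mul1r.
Qed.

Lemma exists_prime_divisor a : factorial -> a != 0 -> ~ divides a 1 ->
  exists2 p, prime_elt p & divides p a.
Proof.
move=> fR /fR[u [[|p s] [u1 ps ->]]] an1.
  by case: an1; rewrite big_nil mulr1.
have [pp _] := (prime_seq_cons p s).1 ps; exists p => //.
by rewrite big_cons mulrCA; apply: dividesMr; exists 1; rewrite mul1r.
Qed.

(** Common primes are divided out one at a time; this stops because each of them uses up one prime
    factor of the nonzero entry [F i0]. *)
Lemma gcd_family (I : finType) (F : I -> R) i0 : factorial -> F i0 != 0 ->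
  exists g G, (forall i, F i = g * G i) /\ primitive G.
Proof.
move=> fR Fi0; have [u [s [u1 ps FE]]] := fR _ Fi0.
have: divides (F i0) (u * \prod_(p <- s) p) by rewrite FE; exists 1; rewrite mul1r.
move: {FE}(size s) {-2}s (erefl (size s)) ps => n.
elim: n F Fi0 => [|n IHn] F Fi0 t st pt Fd; last first.
  (* Only primes in [t] need testing: a prime dividing every entry divides [F i0], hence is
     associate to one of them. *)
  case: (classic (exists2 p, p \in t & forall i, divides p (F i))); last first.
    move=> noprime; exists 1, F; split=> [i|q pq]; first by rewrite mul1r.
    apply: NNPP => allq; have qF i : divides q (F i).
      by apply: NNPP => nq; apply: allq; exists i.
    have [q0 qn1 qM] := pq.
    have /qM[qu|] := divides_trans (qF i0) Fd.
      by apply: qn1; apply: divides_trans u1.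
    move=> /(prime_divides_prod pq)[r rt qr]; apply: noprime; exists r => // i.
    by apply: divides_trans (qF i); apply: prime_divides_prime => //; apply: pt.
  move=> [p pin pF]; have [G FG] := fin_all_exists pF.
  have [p0 _ _] := pt p pin.
  have Gi0 : G i0 != 0 by apply: contraNneq Fi0 => G0; rewrite FG G0 mul0r.
  have [|||g [H [GH pH]]] := IHn G Gi0 (rem p t).
  - by rewrite size_rem // st.
  - by move=> q /mem_rem; apply: pt.
  - case: Fd => c; rewrite (big_rem p) //= FG => cE; exists c.
    by apply: (mulfI p0); rewrite mulrCA cE; ring.
  exists (g * p), H; split=> // i; rewrite FG GH; ring.
exists 1, F; split=> [i|p [p0 pn1 pM]]; first by rewrite mul1r.
exists i0 => dp; apply: pn1; apply: divides_trans dp _.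
by move: Fd; rewrite (size0nil st) big_nil mulr1 => /divides_trans; apply.
Qed.

(* An element dividing all a * F i divides a, one prime factor at a time. *)
Lemma primitive_parallel (I : Type) (F w : I -> R) i0 :
  factorial -> F i0 != 0 -> primitive F ->
  (forall i j, w i * F j = w j * F i) -> exists h, forall i, w i = h * F i.
Proof.
move=> fR Fi0 pF wF.
have cancel c a : c != 0 -> (forall i, divides c (a * F i)) -> divides c a.
  move=> /fR[u [s [u1 ps ->]]].
  elim: s ps a => [|p s IHs] ps a dF.
    by rewrite big_nil mulr1; apply: divides_unit.
  have [[p0 pn1 pM] ps'] := (prime_seq_cons p s).1 ps.
  have [i npi] : exists i, ~ divides p (F i) by apply: pF.
  have [b aE] : divides p a.
    have: divides p (a * F i).
      apply: divides_trans (dF i); rewrite big_cons mulrCA.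
      by apply: dividesMr; exists 1; rewrite mul1r.
    by case/pM.
  have [|e bE] := IHs ps' b.
    move=> j; have [e] := dF j; rewrite big_cons aE => eE; exists e.
    by apply: (mulfI p0); rewrite mulrA (mulrC p) eE; ring.
  by exists e; rewrite big_cons aE bE; ring.
have [h hE] : divides (F i0) (w i0).
  by apply: cancel => // j; exists (w j); rewrite wF.
by exists h => i; apply: (mulIf Fi0); rewrite wF hE; ring.
Qed.

Definition squarefree a :=
  forall p, prime_elt p -> ~ divides (p * p) a.

(** Suppose p^2 divides a l. If p divides l, the two are associates, and cancelling l leaves l
    dividing a; otherwise both factors p must come from a. *)
Lemma squarefreeM_prime a l : squarefree a ->
  prime_elt l -> ~ divides l a -> squarefree (a * l).
Proof.
move=> sa pl nla p pp [c E]; have [l0 _ lM] := pl; have [p0 _ pM] := pp.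
have [pdl|npl] := classic (divides p l).
  have [e pE] := prime_divides_prime pp pl pdl.
  apply: nla; exists (c * e * e); apply: (mulIf l0); rewrite E pE; ring.
have [a1 aE] : divides p a.
  have /pM[] // : divides p (a * l) by rewrite E; exists (c * p); ring.
have [a2 a1E] : divides p a1.
  have /pM[] // : divides p (a1 * l).
  by exists c; apply: (mulIf p0); move: E; rewrite aE => E; rewrite mulrAC E; ring.
by apply: (sa p pp); exists a2; rewrite aE a1E; ring.
Qed.

End Divisibility.

Lemma rmorph_divides (R T : idomainType) (f : {rmorphism R -> T}) a b :
  divides a b -> divides (f a) (f b).
Proof. by case=> c ->; exists (f c); rewrite rmorphM. Qed.

Lemma factorial_iso (R T : idomainType) (f : {rmorphism R -> T})
  (g : {rmorphism T -> R}) :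
  cancel f g -> cancel g f -> factorial T -> factorial R.
Proof.
move=> fK gK fT a a0.
have fa0 : f a != 0 by rewrite -(rmorph0 f) (inj_eq (can_inj fK)).
have [u [s [u1 ps faE]]] := fT _ fa0.
exists (g u), (map g s); split.
- by have := rmorph_divides g u1; rewrite rmorph1.
- move=> _ /mapP[p /ps[p0 pn1 pM] ->]; split.
  + by rewrite -(rmorph0 g) (inj_eq (can_inj gK)).
  + by move=> /(rmorph_divides f); rewrite gK rmorph1.
  + move=> b c /(rmorph_divides f); rewrite gK rmorphM => /pM.
    by case=> /(rmorph_divides g); rewrite fK; [left|right].
- by rewrite -[LHS]fK faE rmorphM rmorph_prod big_map.
Qed.

Section Gauss.
Variable R : idomainType.
Hypothesis fR : factorial R.
Implicit Types (f g h q : {poly R}).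
Import Pdiv.Idomain.

Definition primitive_poly f := forall p : R, prime_elt p -> ~ divides p%:P f.

(** For nonzero p, comparing constant terms shows that the cofactor of p is itself divisible by
    X. *)
Lemma divides_polyC_mulX (p : R) f : divides p%:P (f * 'X) -> divides p%:P f.
Proof.
case=> c; elim/poly_ind: c => [|c e _].
  rewrite mul0r => /eqP; rewrite mulf_eq0 polyX_eq0 orbF => /eqP->.
  exact: divides0.
have [->|p0] := eqVneq p 0.
  rewrite mulr0 => /eqP; rewrite mulf_eq0 polyX_eq0 orbF => /eqP->.
  exact: divides0.
move=> E; move: (congr1 (fun q => q`_0) E).
rewrite coefMX coefMC coefD coefMX add0r coefC /= => /esym/eqP.
rewrite mulf_eq0 (negbTE p0) orbF => /eqP e0.
exists c; apply: (mulIf (negbT (polyX_eq0 R))); rewrite E e0 polyC0 addr0; ring.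
Qed.

(** Induction on both factors: p divides the product of their constant terms, hence one of these.
    Removing that constant leaves a product divisible by X, and X can be cancelled. *)
Lemma prime_polyC (p : R) : prime_elt p -> prime_elt p%:P.
Proof.
move=> [p0 pn1 pM]; split; first by rewrite polyC_eq0.
  by case=> c /(congr1 (fun q => q`_0)); rewrite coefMC coef1 => E; case: pn1; exists c`_0.
elim/poly_ind => [|a c IHa] b; first by left; apply: divides0.
elim/poly_ind: b => [|b e IHb]; first by right; apply: divides0.
move=> dab.
have /pM[[c' cE]|[e' eE]] : divides p (c * e).
- case: dab => q /(congr1 (fun q => q`_0)).
  by rewrite coefMC coef0M !coefD !coefMX !coefC !add0r; exists q`_0.
- have cp : divides p%:P c%:P by exists c'%:P; rewrite -polyCM cE.
  have : divides p%:P (a * (b * 'X + e%:P)).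
    apply: divides_polyC_mulX.
    have := dividesB dab (dividesMr (b * 'X + e%:P) cp).
    by rewrite -mulrBl addrK mulrAC.
  by case/IHa => dp; [left; apply: dividesD => //; apply: dividesMr|right].
- have ep : divides p%:P e%:P by exists e'%:P; rewrite -polyCM eE.
  have : divides p%:P ((a * 'X + c%:P) * b).
    apply: divides_polyC_mulX.
    have := dividesB dab (dividesMl (a * 'X + c%:P) ep).
    by rewrite -mulrBr addrK mulrA.
  by case/IHb => dp; [left|right; apply: dividesD => //; apply: dividesMr].
Qed.

Lemma primitive_polyM f g : primitive_poly (f * g) ->
  primitive_poly f /\ primitive_poly g.
Proof.
move=> pfg; split=> p pp dp; apply: (pfg p pp).
  exact: dividesMr.
exact: dividesMl.
Qed.

(** The primes of c are cancelled one by one: each stays prime in R[X] and does not divide the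
    primitive f, so it divides q. *)
Lemma gauss_cancel (c : R) f g q : c != 0 -> primitive_poly f ->
  c%:P * g = q * f -> divides f g.
Proof.
move=> /fR[u [s [[v vu] ps ->]]] pf.
elim: s ps q => [|p s IHs] ps q.
  rewrite big_nil mulr1 => E; exists (v%:P * q).
  by rewrite -mulrA -E mulrA -polyCM -vu mul1r.
have [pp ps'] := (prime_seq_cons p s).1 ps.
have [p0 _ pM] := prime_polyC pp.
rewrite big_cons mulrCA polyCM -mulrA => E.
have /pM[[q' qE]|/(pf _ pp)//] : divides p%:P (q * f).
  by rewrite -E mulrC; exists ((u * \prod_(j <- s) j)%:P * g).
apply: (IHs ps' q'); apply: (mulfI p0); rewrite E qE; ring.
Qed.

Lemma content_primitive f : f != 0 ->
  exists c g, [/\ c != 0, f = c%:P * g & primitive_poly g].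
Proof.
move=> f0; have sf : ((size f).-1 < size f)%N by rewrite ltn_predL size_poly_gt0.
pose k := Ordinal sf.
have [|g [G [FG pG]]] := @gcd_family _ _ (fun i : 'I_(size f) => f`_i) k fR.
  by rewrite -lead_coefE lead_coef_eq0.
(* [G] is indexed by ordinals below [size f], so [insub] never falls back to the default 0 in this
   range. *)
exists g, (\poly_(i < size f) (if insub i is Some j then G j else 0)).
have E : f = g%:P * \poly_(i < size f) (if insub i is Some j then G j else 0).
  apply/polyP => i; rewrite coefCM coef_poly; case: ltnP => [lt|ge].
    by rewrite insubT /= -FG.
  by rewrite mulr0 nth_default.
split=> //; first by apply: contraNneq f0 => g0; rewrite E g0 mul0r.
move=> p /pG[i ni] [q qE]; apply: ni; exists q`_i.
have := congr1 (fun q => q`_i) qE; rewrite coefMC coef_poly ltn_ord.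
by rewrite valK.
Qed.

(* Pseudo-division makes gcdp f g divide f up to a scalar; primitivity of f
   removes the scalar, and irreducibility leaves two cases for the gcd. *)
Lemma irreducible_prime f : primitive_poly f -> (1 < size f)%N ->
  (forall g h, f = g * h -> size g = 1%N \/ size h = 1%N) -> prime_elt f.
Proof.
move=> pf sf irr; have f0 : f != 0 by rewrite -size_poly_gt0 ltnW.
split=> //.
  case=> c cf; have c0 : c != 0.
    by apply/eqP => c0; move/eqP: cf; rewrite c0 mul0r oner_eq0.
  have := size_mul c0 f0; rewrite -cf size_poly1.
  move: sf; rewrite -(size_poly_gt0 c) in c0.
  by case: (size c) c0 => // n _; case: (size f) => [|[|m]] //= _; rewrite !addnS.
have dvdp_divides g : f %| g -> divides f g.
  move=> /dvdpP[[c q] /= c0]; rewrite -mul_polyC; exact: gauss_cancel.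
move=> g h fgh.
have fdvd : f %| g * h by case: fgh => q ->; apply: dvdp_mulIr.
have [cop|ncop] := boolP (coprimep f g).
  by right; apply: dvdp_divides; rewrite -(Gauss_dvdpr _ cop).
left; apply: dvdp_divides.
have d0 : gcdp f g != 0 by rewrite gcdp_eq0 (negbTE f0).
have [k [d1 [k0 dE pd1]]] := content_primitive d0.
have s1 : size d1 = size (gcdp f g) by rewrite dE mul_polyC size_scale.
have /dvdpP[[c q] /= c0 E] := dvdp_gcdl f g.
have [q1 fE] : divides d1 f.
  apply: (@gauss_cancel c _ _ (q * k%:P)) => //.
  by rewrite mul_polyC E {1}dE mulrA.
have [sq|sd] := irr _ _ fE; last by rewrite coprimep_def -s1 sd in ncop.
apply: dvdp_trans (dvdp_gcdr f g).
rewrite dE mul_polyC dvdpZr // fE.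
move/eqP: sq => /size_poly1P[e e0 ->].
by rewrite mul_polyC dvdpZl // dvdpp.
Qed.

(** The content factors in R. A primitive polynomial is a unit, or irreducible and hence prime, or a
    product of two primitive polynomials of smaller size. *)
Lemma factorial_poly : factorial {poly R}.
Proof.
have primcase n f : (size f <= n)%N -> f != 0 -> primitive_poly f -> factors f.
  elim: n f => [|n IHn] f sf f0 pf.
    by move: f0; rewrite -size_poly_gt0 ltnNge sf.
  have [s1|s1] := leqP (size f) 1.
    have [c cE] : exists c, f = c%:P by exists f`_0; apply: size1_polyC.
    have c0 : c != 0 by rewrite -polyC_eq0 -cE.
    have [[v cv]|cn1] := classic (divides c 1).
      by rewrite cE; apply: factors_unit; exists v%:P; rewrite -polyCM -cv.
    have [p pp [e pc]] := exists_prime_divisor fR c0 cn1.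
    by case: (pf p pp); exists e%:P; rewrite cE pc polyCM.
  have [irr|red] := classic (forall g h, f = g * h -> size g = 1%N \/ size h = 1%N).
    by apply: factors_prime; apply: irreducible_prime.
  apply: NNPP => nf; apply: red => g h E; apply: NNPP => /not_or_and[sg sh].
  have : g * h != 0 by rewrite -E.
  rewrite mulf_eq0 negb_or => /andP[g0 h0].
  have := size_mul g0 h0; rewrite -E => sE.
  have := size_poly_gt0 g; rewrite g0 => sg0.
  have := size_poly_gt0 h; rewrite h0 => sh0.
  have [pg ph] : primitive_poly g /\ primitive_poly h.
    by apply: primitive_polyM; rewrite -E.
  move/eqP: sg => sg; move/eqP: sh => sh.
  apply: nf; rewrite E; apply: factorsM; apply: IHn => //; lia.
move=> f f0; have [c [g [c0 fE pg]]] := content_primitive f0.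
rewrite fE; apply: factorsM.
  have [u [s [[v uv] ps ->]]] := fR c0.
  exists u%:P, (map polyC s); split.
  - by exists v%:P; rewrite -polyCM -uv.
  - by move=> _ /mapP[p /ps pp ->]; apply: prime_polyC.
  - by rewrite polyCM rmorph_prod big_map.
apply: (primcase (size g)) => //.
by apply: contraNneq f0 => g0; rewrite fE g0 mulr0.
Qed.

End Gauss.

(** * Factoriality in several variables, by adjoining one variable at a time *)

Lemma rmorph_mpoly_eq (n : nat) (R A : comNzRingType)
  (f g : {rmorphism {mpoly R[n]} -> A}) :
  (forall c, f c%:MP = g c%:MP) -> (forall i, f 'X_i = g 'X_i) -> f =1 g.
Proof.
move=> fgC fgX p; rewrite (mpolyE p) !rmorph_sum; apply: eq_bigr => m _.
rewrite -mul_mpolyC !rmorphM fgC; congr (_ * _).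
rewrite mpolyXE_id !rmorph_prod; apply: eq_bigr => i _.
by rewrite !rmorphXn fgX.
Qed.

Section MpolyFactorial.
Variables (K : fieldType) (n : nat).

(** Inverse of [muni]: widen the coefficients, then evaluate at the last variable. *)
Local Notation multi :=
  (horner_eval ('X_ord_max : {mpoly K[n.+1]}) \o map_poly (@mwiden n K)).

Lemma muni_X (i : 'I_n.+1) : muni 'X_i =
  match split (cast_ord (esym (addn1 n)) i) with
  | inl j => ('X_j)%:P | inr _ => 'X end :> {poly {mpoly K[n]}}.
Proof. by rewrite /muni mmapX mmap1U. Qed.

Lemma muni_widen (j : 'I_n) :
  muni 'X_(widen_ord (leqnSn n) j) = ('X_j)%:P :> {poly {mpoly K[n]}}.
Proof.
rewrite muni_X; case: splitP => [k /= E|k /= E].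
  by congr ('X__)%:P; apply: val_inj.
by have := ltn_ord j; rewrite E ltnNge leq_addr.
Qed.

Lemma muni_max : muni 'X_ord_max = 'X :> {poly {mpoly K[n]}}.
Proof.
rewrite muni_X; case: splitP => [k /= E|//].
by have := ltn_ord k; rewrite -E ltnn.
Qed.

Lemma muniK : cancel (@muni n K) multi.
Proof.
apply: (@rmorph_mpoly_eq _ _ _ (multi \o @muni n K) idfun) => [c|i] /=.
  by rewrite muniC /= map_polyC /horner_eval /= hornerC mwidenC.
case: (unliftP ord_max i) => [j|] ->.
  have -> : lift ord_max j = widen_ord (leqnSn n) j.
    by apply: val_inj; rewrite /= /bump leqNgt ltn_ord.
  rewrite muni_widen /= map_polyC /horner_eval /= hornerC mwidenX.
  by rewrite mnmwiden1.
by rewrite muni_max /= map_polyX /horner_eval /= hornerX.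
Qed.

Lemma muni_mwiden (c : {mpoly K[n]}) : muni (mwiden c) = c%:P.
Proof.
move: c; apply: (@rmorph_mpoly_eq _ _ _ (@muni n K \o @mwiden n K) polyC) => [c|i] /=.
  by rewrite mwidenC muniC.
by rewrite mwidenX mnmwiden1 muni_widen.
Qed.

Lemma multiK : cancel multi (@muni n K).
Proof.
elim/poly_ind => [|p c IHp]; first by rewrite !rmorph0.
rewrite rmorphD rmorphM /= muniD muniM IHp.
rewrite /= map_polyC map_polyX /horner_eval /= hornerC hornerX.
by rewrite muni_mwiden muni_max.
Qed.

Lemma factorial_mpolyS : factorial {mpoly K[n]} -> factorial {mpoly K[n.+1]}.
Proof.
by move=> /factorial_poly; apply: factorial_iso muniK multiK.
Qed.

End MpolyFactorial.

Lemma factorial_mpoly (K : fieldType) n : factorial {mpoly K[n]}.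
Proof.
elim: n => [|n IHn]; last exact: factorial_mpolyS.
move=> a a0; apply: factors_unit.
have aE : a = (a@_0)%:MP.
  apply/mpolyP => m; rewrite mcoeffC.
  have -> : m = 0%MM by apply/mnmP; case.
  by rewrite eqxx mulr1.
have c0 : a@_0 != 0 by rewrite -(mpolyC_eq0 0) -aE.
by exists (a@_0)^-1%:MP; rewrite {2}aE -mpolyCM mulVf ?mpolyC1.
Qed.

(** * Homogeneous polynomials *)

(** For n > 0 the product has zero constant term, so one of the factors is divisible by X, and X is
    cancelled. *)
Lemma mul_eq_monomial (R : idomainType) (A B : {poly R}) c n :
  c != 0 -> A * B = c%:P * 'X^n -> exists a k, A = a%:P * 'X^k.
Proof.
move=> c0; elim: n A B => [|n IHn] A B.
  rewrite mulr1 => E; exists A`_0, 0%N; rewrite mulr1; apply: size1_polyC.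
  have AB0 : A * B != 0 by rewrite E polyC_eq0.
  have := congr1 (fun p => size (p : {poly R})) E.
  move: AB0; rewrite mulf_eq0 negb_or => /andP[A0 B0].
  have := size_poly_gt0 A; have := size_poly_gt0 B.
  rewrite size_mul // size_polyC c0 A0 B0; lia.
have X0 : 'X != 0 :> {poly R} by rewrite polyX_eq0.
elim/poly_ind: A => [|A a _]; first by exists 0, 0%N; rewrite polyC0 mul0r.
elim/poly_ind: B => [|B b _].
  rewrite mulr0 => /esym/eqP.
  by rewrite mulf_eq0 polyC_eq0 (negbTE c0) expf_eq0 (negbTE X0) andbF.
move=> E; have := congr1 (fun p : {poly R} => p`_0) E.
rewrite coef0M !coefD !coefMX !coefC coefCM coefXn !add0r /= mulr0 => /eqP.
rewrite mulf_eq0 => /orP[] /eqP z0.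
  have [|a' [k ->]] := IHn A (B * 'X + b%:P).
    by apply: (mulIf X0); move: E; rewrite z0 exprSr polyC0 addr0 mulrA -mulrAC.
  by exists a', k.+1; rewrite z0 polyC0 addr0 exprSr mulrA.
apply: (IHn _ B); apply: (mulIf X0); move: E.
by rewrite z0 exprSr polyC0 addr0 !mulrA.
Qed.

Section Homogeneous.
Variables (K : numFieldType) (n : nat).
Implicit Types (p q : {mpoly K[n]}) (d k : nat).

(* p(t X_1, ..., t X_n) as a polynomial in t; p is homogeneous exactly when
   this is a monomial in t. *)
Definition grading p : {poly {mpoly K[n]}} :=
  mmap (polyC \o @mpolyC n K) (fun i => ('X_i)%:P * 'X) p.

Lemma gradingE p :
  grading p = \sum_(m <- msupp p) (p@_m *: 'X_[m])%:P * 'X^(mdeg m).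
Proof.
apply: eq_bigr => m _; rewrite /= -mul_mpolyC polyCM -mulrA; congr (_ * _).
rewrite /mmap1 mpolyXE_id rmorph_prod mdegE -prodrXr -big_split /=.
by apply: eq_bigr => i _; rewrite exprMn rmorphXn.
Qed.

Lemma grading_homog p d : p \is d.-homog -> grading p = p%:P * 'X^d.
Proof.
move=> /dhomogP pd; rewrite gradingE {3}(mpolyE p) rmorph_sum mulr_suml.
by apply: eq_big_seq => m /pd ->.
Qed.

Lemma homog_grading p q d : grading p = q%:P * 'X^d -> p \is d.-homog.
Proof.
move=> E; apply/dhomogP => m mp; apply: NNPP => /eqP md.
have := congr1 (fun r : {poly {mpoly K[n]}} => (r`_(mdeg m))@_m) E.
rewrite coefCM coefXn (negbTE md) mulr0 mcoeff0 gradingE coef_sum.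
rewrite raddf_sum (bigD1_seq m) //= coefCM coefXn eqxx mulr1 mcoeffZ mcoeffX.
rewrite eqxx mulr1 big1 ?addr0 => [|m' mm'].
  by move/eqP; apply/negP; rewrite -mcoeff_msupp.
by rewrite coefCM coefXn mulr_natr mcoeffMn mcoeffZ mcoeffX (negbTE mm') mulr0 mul0rn.
Qed.

(** [grading] is multiplicative and turns homogeneous polynomials into monomials in t, and a factor
    of a nonzero monomial is a monomial. *)
Lemma homog_factor p q d : p * q != 0 -> p * q \is d.-homog ->
  exists2 k, p \is k.-homog & exists2 j, q \is j.-homog & d = (k + j)%N.
Proof.
have factor (r s : {mpoly K[n]}) : r * s != 0 -> r * s \is d.-homog -> exists k, r \is k.-homog.
  move=> rs0 /grading_homog.
  have -> : grading (r * s) = grading r * grading s by rewrite /grading rmorphM.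
  by case/(mul_eq_monomial rs0)=> a [k E]; exists k; apply: homog_grading E.
move=> pq0 pqd; have [k pk] := factor p q pq0 pqd.
have [|| j qj] := factor q p; rewrite ?(mulrC q) //.
exists k => //; exists j => //.
by apply: dhomog_uniq pq0 pqd (dhomogM pk qj).
Qed.

Lemma mderiv_homog p d i : p \is d.-homog -> mderiv i p \is d.-1.-homog.
Proof.
move=> /dhomogP pd; apply/dhomogP => m; rewrite mcoeff_msupp mcoeff_deriv => mp.
have : p@_(m + U_(i)) != 0 by apply: contraNneq mp => ->; rewrite mul0rn.
by rewrite -mcoeff_msupp => /pd /= <-; rewrite mdegD mdeg1 addn1.
Qed.

Lemma euler_homog p d : p \is d.-homog ->
  \sum_(i < n) 'X_i * mderiv i p = d%:R * p.
Proof.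
move=> /dhomogP pd.
have Xd i m : 'X_i * mderiv i 'X_[m] = (m i)%:R * 'X_[m] :> {mpoly K[n]}.
  rewrite mderivX -scalerAr scaler_nat mulr_natl.
  case mi : (m i) => [|k]; first by rewrite !mulr0n.
  rewrite -mpolyXD addmC submK //.
  by apply/mnm_lepP => j; rewrite mnm1E; case: eqP => // <-; rewrite mi.
rewrite [in RHS](mpolyE p) mulr_sumr.
have dE i : 'X_i * mderiv i p =
    \sum_(m <- msupp p) 'X_i * mderiv i (p@_m *: 'X_[m]).
  by rewrite {1}(mpolyE p) raddf_sum mulr_sumr.
rewrite (eq_bigr _ (fun i _ => dE i)).
rewrite exchange_big /=; apply: eq_big_seq => m /pd /= md.
rewrite -md mdegE natr_sum mulr_suml; apply: eq_bigr => i _.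
by rewrite mderivZ -!scalerAr Xd.
Qed.

Lemma mnm_neq0_gt0 (m : 'X_{1..n}) : m != 0%MM -> exists i, (0 < m i)%N.
Proof.
move=> /eqP m0; apply: NNPP => nm; apply: m0; apply/mnmP => i; rewrite mnm0E.
by apply: NNPP => mi; apply: nm; exists i; rewrite lt0n; apply/eqP.
Qed.

(** Characteristic zero matters: a coefficient of [p] reappears in a derivative multiplied by a
    positive exponent. *)
Lemma mderiv_eq0 p : (forall i, mderiv i p = 0) -> p = (p@_0)%:MP.
Proof.
move=> dp; apply/mpolyP => m; rewrite mcoeffC.
have [->|m0] := eqVneq m 0%MM; first by rewrite mulr1.
have [i mi] := mnm_neq0_gt0 m0.
have := congr1 (mcoeff (m - U_(i))%MM) (dp i); rewrite mcoeff_deriv mcoeff0.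
rewrite submK; last by apply/mnm_lepP => j; rewrite mnm1E; case: eqP => // <-.
by move/eqP; rewrite mulrn_eq0 /= mulr0 => /eqP.
Qed.

Lemma homog0C p : p \is 0.-homog -> p = (p@_0)%:MP.
Proof.
move=> /dhomogP p0; apply/mpolyP => m; rewrite mcoeffC.
have [->|m0] := eqVneq m 0%MM; first by rewrite mulr1.
rewrite mulr0; apply: memN_msupp_eq0.
by apply: contraNN m0 => /p0 /= /eqP; rewrite mdeg_eq0.
Qed.

Lemma divides_msize p q : q != 0 -> divides p q -> (msize p <= msize q)%N.
Proof.
move=> q0 [c E]; have : c * p != 0 by rewrite -E.
rewrite mulf_eq0 negb_or => /andP[c0 p0]; rewrite E msizeM //.
by rewrite (mpolySpred _ c0) /= leq_addl.
Qed.

Lemma msize_mderiv p i : p != 0 -> (msize (mderiv i p) < msize p)%N.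
Proof.
move=> p0; rewrite msizeE (mpolySpred _ p0) ltnS.
apply/bigmax_leqP_seq => m; rewrite mcoeff_msupp mcoeff_deriv => mp _.
have : p@_(m + U_(i)) != 0 by apply: contraNneq mp => ->; rewrite mul0rn.
rewrite -mcoeff_msupp => /msize_mdeg_lt; rewrite mdegD mdeg1 addn1.
by rewrite (mpolySpred _ p0) ltnS.
Qed.

Lemma msize_unit p : divides p 1 -> msize p = 1%N.
Proof.
move=> p1; have := divides_msize (oner_neq0 _) p1.
by rewrite msize1 (mpolySpred _ (unit_neq0 p1)); case: (msize p).-1.
Qed.

Lemma msize1_unit p : p != 0 -> (msize p <= 1)%N -> divides p 1.
Proof.
move=> p0 /msize1_polyC E; exists (p@_0)^-1%:MP.
by rewrite {2}E -mpolyCM mulVf ?mpolyC1 // -(mpolyC_eq0 n) -E.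
Qed.

(* Euler's relation puts p in F, and F = p q then gives p | (d_i p) q. *)
Lemma square_of_common_divisor F d p : F \is d.-homog -> (0 < d)%N ->
  prime_elt p -> (forall i, divides p (mderiv i F)) -> divides (p * p) F.
Proof.
move=> Fd d0 [p0 pn1 pM] pF.
have d0' : d%:R != 0 :> K by rewrite pnatr_eq0 -lt0n.
have [q FE] : divides p F.
  have: divides p (d%:R * F).
    rewrite -(euler_homog Fd); elim/big_ind: _ => [|x y|i _].
    - exact: divides0.
    - exact: dividesD.
    - exact/dividesMl/pF.
  case=> c E; exists (d%:R^-1 *: c).
  by rewrite -scalerAl -E mulr_natl -scaler_nat scalerA mulVf ?scale1r.
have [[r qE]|npq] := classic (divides p q).
  by exists r; rewrite FE qE; ring.
case: pn1; apply: msize1_unit => //; rewrite (mderiv_eq0 (p := p)); last first.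
  move=> i; apply: NNPP => /eqP dp0.
  have /pM[] : divides p (q * mderiv i p).
  - have [c E] := pF i; move: E; rewrite FE mderivM => E.
    by exists (c - mderiv i q); rewrite mulrBl -E addrC addKr.
  - exact: npq.
  - by move/(divides_msize dp0); rewrite leqNgt msize_mderiv.
by rewrite msizeC; case: eqP.
Qed.

Lemma comp_mpoly_homog (t : n.-tuple {mpoly K[n]}) p d :
  (forall i, tnth t i \is 1.-homog) -> p \is d.-homog -> comp_mpoly t p \is d.-homog.
Proof.
move=> t1 /dhomogP pd; rewrite comp_mpolyE.
rewrite big_seq; apply: rpred_sum => m /pd /= <-; apply: dhomogZ.
rewrite mdegE; elim/big_ind2: _ => [|? ? ? ? |i _]; first exact: dhomog1.
  exact: dhomogM.
by have := dhomogMn (m i) (t1 i); rewrite mul1n.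
Qed.

Lemma meval_homog p k : (0 < k)%N -> p \is k.-homog -> p.@[fun=> 0] = 0.
Proof.
move=> k0 /dhomogP pk; rewrite mevalE big_seq big1 // => m /pk /= mk.
have [|i mi] := @mnm_neq0_gt0 m; first by rewrite -mdeg_eq0 mk -lt0n.
by rewrite (bigD1 i) //= expr0n gtn_eqF // mul0r mulr0.
Qed.

Lemma homog0_unit p : p != 0 -> p \is 0.-homog -> divides p 1.
Proof.
move=> p0 /homog0C E; apply: msize1_unit => //.
by rewrite E msizeC; case: eqP.
Qed.

(* phi substitutes into one variable so as to kill l. *)
Lemma linear_reduction (l : {mpoly K[n]}) : l != 0 -> l \is 1.-homog ->
  exists phi : {rmorphism {mpoly K[n]} -> {mpoly K[n]}},
  [/\ forall c, phi c%:MP = c%:MP, forall p, divides l (p - phi p), phi l = 0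
    & forall p d, p \is d.-homog -> phi p \is d.-homog].
Proof.
move=> l0 l1; have lE : l = \sum_(i < n) l@_U_(i) *: 'X_i.
  rewrite -[LHS]mul1r -(euler_homog l1); apply: eq_bigr => i _.
  rewrite mulrC (homog0C (mderiv_homog i l1)) mul_mpolyC.
  by rewrite mcoeff_deriv add0m mnm0E.
have [k lk] : exists k : 'I_n, l@_U_(k) != 0.
  apply: NNPP => nl; move/eqP: l0; apply; rewrite lE big1 // => i _.
  by have [->|li] := eqVneq l@_U_(i) 0; rewrite ?scale0r //; case: nl; exists i.
pose t := [tuple ('X_i - (i == k)%:R *: ((l@_U_(k))^-1 *: l)) | i < n].
exists (comp_mpoly t); split=> [c|p||p d pd].
- exact: comp_mpolyC.
- rewrite /= {1}(mpolyE p) comp_mpolyE -sumrB; elim/big_ind: _ => [|x y|m _].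
  + exact: divides0.
  + exact: dividesD.
  + rewrite -scalerBr -mul_mpolyC; apply: dividesMl.
    rewrite mpolyXE_id; elim/big_ind2: _ => [|x1 x2 y1 y2 d1 d2|i _].
    * by rewrite subrr; apply: divides0.
    * have -> : x2 * y2 - x1 * y1 = (x2 - x1) * y2 + x1 * (y2 - y1) by ring.
      by apply: dividesD; [apply: dividesMr|apply: dividesMl].
    * rewrite subrXX; apply: dividesMr; rewrite tnth_mktuple opprB addrCA subrr addr0.
      by rewrite scalerA -mul_mpolyC; apply: dividesMl; exists 1; rewrite mul1r.
- rewrite {1}lE rmorph_sum /=.
  under eq_bigr do rewrite comp_mpolyZ comp_mpolyXU -tnth_nth tnth_mktuple scalerBr.
  rewrite sumrB -lE (bigD1 k) //= eqxx scale1r scalerA divff // scale1r.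
  by rewrite big1 ?addr0 ?subrr // => i /negbTE->; rewrite scale0r scaler0.
- apply: comp_mpoly_homog pd => i; rewrite tnth_mktuple.
  by apply: rpredB; [rewrite dhomogX /= mdeg1|do 2!apply: dhomogZ].
Qed.

End Homogeneous.

(** * Syzygies and cross products *)

Lemma ord3P (P : 'I_3 -> Prop) : P ix -> P iy -> P iz -> forall i, P i.
Proof.
move=> Px Py Pz [[|[|[|//]]] lti].
- by rewrite (_ : Ordinal lti = ix) //; apply: val_inj.
- by rewrite (_ : Ordinal lti = iy) //; apply: val_inj.
- by rewrite (_ : Ordinal lti = iz) //; apply: val_inj.
Qed.

Lemma sum3 (V : nmodType) (F : 'I_3 -> V) :
  \sum_(i < 3) F i = F ix + F iy + F iz.
Proof.
rewrite !big_ord_recl big_ord0 addr0 addrA.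
by congr (F _ + F _ + F _); apply: val_inj.
Qed.

Section Cross.
Variable R : idomainType.
Implicit Types (u v w F : 'I_3 -> R).

Definition vec3 (a b c : R) (i : 'I_3) : R :=
  match val i with 0%N => a | 1%N => b | _ => c end.

Definition cross u v : 'I_3 -> R :=
  vec3 (u iy * v iz - u iz * v iy) (u iz * v ix - u ix * v iz)
       (u ix * v iy - u iy * v ix).

Lemma cross_comb u v (a b c d : R) i :
  cross (fun i => a * u i + b * v i) (fun i => c * u i + d * v i) i =
  (a * d - b * c) * cross u v i.
Proof. by move: i; apply: ord3P; rewrite /cross /vec3 /=; ring. Qed.

Lemma eq_cross u u' v v' : u =1 u' -> v =1 v' -> cross u v =1 cross u' v'.
Proof. by move=> uE vE; apply: ord3P; rewrite /cross /vec3 /= !uE !vE. Qed.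

(** Componentwise form of (u x v) x F = (u.F) v - (v.F) u, whose right side vanishes here. *)
Lemma cross_orthogonal u v F : \sum_i u i * F i = 0 -> \sum_i v i * F i = 0 ->
  forall i j, cross u v i * F j = cross u v j * F i.
Proof.
rewrite !sum3 => uF vF.
have xy : cross u v ix * F iy = cross u v iy * F ix.
  apply/eqP; rewrite -subr_eq0; apply/eqP.
  transitivity (v iz * (u ix * F ix + u iy * F iy + u iz * F iz)
    - u iz * (v ix * F ix + v iy * F iy + v iz * F iz)).
    by rewrite /cross /vec3 /=; ring.
  by rewrite uF vF; ring.
have yz : cross u v iy * F iz = cross u v iz * F iy.
  apply/eqP; rewrite -subr_eq0; apply/eqP.
  transitivity (v ix * (u ix * F ix + u iy * F iy + u iz * F iz)
    - u ix * (v ix * F ix + v iy * F iy + v iz * F iz)).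
    by rewrite /cross /vec3 /=; ring.
  by rewrite uF vF; ring.
have zx : cross u v iz * F ix = cross u v ix * F iz.
  apply/eqP; rewrite -subr_eq0; apply/eqP.
  transitivity (v iy * (u ix * F ix + u iy * F iy + u iz * F iz)
    - u iy * (v ix * F ix + v iy * F iy + v iz * F iz)).
    by rewrite /cross /vec3 /=; ring.
  by rewrite uF vF; ring.
by apply: ord3P; apply: ord3P.
Qed.

Lemma cross_eq0 u v : (forall i, cross u v i = 0) ->
  forall i j, u i * v j = u j * v i.
Proof.
move=> uv0; have := uv0 ix; have := uv0 iy; have := uv0 iz.
rewrite /cross /vec3 /= => /subr0_eq z /subr0_eq y /subr0_eq x.
by apply: ord3P; apply: ord3P; rewrite ?x ?y ?z.
Qed.

(* The Koszul syzygies are combinations of u and v, and the cross product of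
   two of them is a multiple of F by an entry of F. *)
Lemma cross_generators (F u v : 'I_3 -> R) k0 :
  factorial R -> F k0 != 0 -> primitive F ->
  \sum_i u i * F i = 0 -> \sum_i v i * F i = 0 ->
  (forall w, \sum_i w i * F i = 0 -> exists a b, forall i, w i = a * u i + b * v i) ->
  exists2 h, divides h 1 & forall i, cross u v i = h * F i.
Proof.
move=> fR Fk0 pF uF vF span.
have [h hE] := primitive_parallel fR Fk0 pF (cross_orthogonal uF vF).
have minor w w' : \sum_i w i * F i = 0 -> \sum_i w' i * F i = 0 ->
    exists m, forall i, cross w w' i = m * (h * F i).
  move=> /span[a [b wE]] /span[c [e w'E]]; exists (a * e - b * c) => i.
  by rewrite (eq_cross wE w'E) cross_comb hE.
pose Kx := vec3 0 (F iz) (- F iy); pose Ky := vec3 (- F iz) 0 (F ix).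
pose Kz := vec3 (F iy) (- F ix) 0.
have hF k : divides h (F k).
  have [m mE] : exists m, forall i, F k * F i = m * (h * F i).
    have Kx0 : \sum_i Kx i * F i = 0 by rewrite sum3 /Kx /vec3 /=; ring.
    have Ky0 : \sum_i Ky i * F i = 0 by rewrite sum3 /Ky /vec3 /=; ring.
    have Kz0 : \sum_i Kz i * F i = 0 by rewrite sum3 /Kz /vec3 /=; ring.
    move: k; apply: ord3P.
    - have [m mE] := minor _ _ Ky0 Kz0; exists m => i; rewrite -mE.
      by move: i; apply: ord3P; rewrite /cross /Ky /Kz /vec3 /=; ring.
    - have [m mE] := minor _ _ Kz0 Kx0; exists m => i; rewrite -mE.
      by move: i; apply: ord3P; rewrite /cross /Kx /Kz /vec3 /=; ring.
    - have [m mE] := minor _ _ Kx0 Ky0; exists m => i; rewrite -mE.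
      by move: i; apply: ord3P; rewrite /cross /Kx /Ky /vec3 /=; ring.
  by exists m; apply: (mulIf Fk0); rewrite mE mulrA.
exists h => //; apply: NNPP => hn1.
have h0 : h != 0.
  by apply: contraNneq Fk0 => h0; have [c ->] := hF k0; rewrite h0 mulr0.
have [p pp ph] := exists_prime_divisor fR h0 hn1.
by have [k] := pF p pp; apply; apply: divides_trans ph (hF k).
Qed.

End Cross.

Section Derivations.
Variables (K : numFieldType) (n : nat).
Notation T := {mpoly K[n]}.
Implicit Types (u v w : 'I_n -> T) (f g l : T).

(** Treating syzygies as derivations makes Leibniz's rule available for comparing [f * l] with [f]
    and [l]. *)
Definition der v f := \sum_i v i * mderiv i f.

Lemma der_comb u v w (a b : T) f : (forall i, w i = a * u i + b * v i) ->
  der w f = a * der u f + b * der v f.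
Proof.
move=> wE; rewrite /der !mulr_sumr -big_split; apply: eq_bigr => i _ /=.
by rewrite wE; ring.
Qed.

Lemma derM v f g : der v (f * g) = der v f * g + f * der v g.
Proof.
rewrite /der mulr_suml mulr_sumr -big_split; apply: eq_bigr => i _ /=.
by rewrite mderivM; ring.
Qed.

Definition homog_vec k v := forall i, v i \is k.-homog.

Lemma der_homog k d v f : homog_vec k v -> f \is d.-homog ->
  der v f \is (k + d.-1).-homog.
Proof.
by move=> vk fd; apply: rpred_sum => i _; apply: dhomogM => //; apply: mderiv_homog.
Qed.

(** The ideal (l) is the kernel of a ring morphism into a domain. *)
Lemma prime_linear l : l != 0 -> l \is 1.-homog -> prime_elt l.
Proof.
move=> l0 l1; have [phi [phiC phiB phil _]] := linear_reduction l0 l1.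
have ker p : phi p = 0 -> divides l p.
  by move=> p0; have := phiB p; rewrite p0 subr0.
split=> // [[c /(congr1 phi)]|a b [c /(congr1 phi)]].
  by rewrite rmorphM phil mulr0 rmorph1 => /eqP; rewrite oner_eq0.
rewrite !rmorphM phil mulr0 => /eqP; rewrite mulf_eq0.
by case/orP=> /eqP/ker; [left|right].
Qed.

Lemma natr_mpoly_eq0 k : (k%:R == 0 :> T) = (k == 0%N).
Proof. by rewrite -mpolyC_nat mpolyC_eq0 pnatr_eq0. Qed.

Lemma gradient_neq0 f d : f \is d.-homog -> (0 < d)%N -> f != 0 ->
  exists i, mderiv i f != 0.
Proof.
move=> fd d0 f0; apply: NNPP => nd.
have := euler_homog fd; rewrite big1 => [/esym/eqP|i _].
  rewrite mulf_eq0 natr_mpoly_eq0 (negbTE f0) orbF.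
  by move=> d0'; move: d0; rewrite (eqP d0').
have [->|di] := eqVneq (mderiv i f) 0; first by rewrite mulr0.
by case: nd; exists i.
Qed.

Lemma primitive_gradient f d : f \is d.-homog -> (0 < d)%N -> squarefree f ->
  primitive (fun i => mderiv i f).
Proof.
move=> fd d0 sf p pp; apply: NNPP => np; apply: (sf p pp).
apply: square_of_common_divisor fd d0 pp _ => i.
by apply: NNPP => npi; apply: np; exists i.
Qed.

(* Adding the right multiple of the Euler derivation moves a syzygy of f l
   to a syzygy of f. *)
Lemma syzygy_of_product f l d e u : f \is d.-homog -> (0 < d)%N ->
  l != 0 -> l \is 1.-homog -> ~ divides l f ->
  homog_vec e u -> der u (f * l) = 0 ->
  exists a t, [/\ forall i, t i = u i + a * 'X_i, homog_vec e t,
    der t f = 0 & divides l (der t l)].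
Proof.
move=> fd d0 l0 l1 nlf ue; rewrite derM => ufl.
have [_ _ lM] := prime_linear l0 l1.
have [a aE] : divides l (der u l).
  have /lM[] // : divides l (f * der u l).
  exists (- der u f); move/eqP: ufl; rewrite addrC addr_eq0 => /eqP ->.
  by rewrite mulNr.
have d0' : d%:R != 0 :> K by rewrite pnatr_eq0 -lt0n.
(* If u(l) = a l, then u(f) = - a f. The Euler derivation multiplies f by d, so adding a/d times it
   kills f. *)
pose c : T := (d%:R^-1)%:MP.
have cd : c * d%:R = 1.
  by rewrite mulr_natr -scaler_nat -mul_mpolyC mulrC -mpolyCM mulVf ?mpolyC1.
have uf : der u f = - (a * f).
  apply: (mulIf l0); apply/eqP; rewrite -subr_eq0 mulNr opprK -ufl aE.
  by apply/eqP; ring.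
pose X i : T := 'X_i.
have tE i : u i + c * a * 'X_i = 1 * u i + c * a * X i by rewrite mul1r.
exists (c * a), (fun i => u i + c * a * 'X_i); split=> // [i||].
- apply: rpredD => //; rewrite -mulrA mul_mpolyC; apply: dhomogZ.
  have [->|a0] := eqVneq a 0; first by rewrite mul0r rpred0.
  have : a * l \is e.-homog by rewrite -aE -[e]addn0; apply: (der_homog ue l1).
  have al0 : a * l != 0 by rewrite mulf_neq0.
  move=> /(homog_factor al0)[k ak [j lj ->]].
  rewrite (dhomog_uniq l0 lj l1); apply: dhomogM => //.
  by rewrite dhomogX /= mdeg1.
- rewrite (der_comb f tE) uf /X /der (euler_homog fd).
  by rewrite (_ : _ + _ = (c * d%:R - 1) * (a * f)); [rewrite cd subrr mul0r|ring].
- rewrite (der_comb l tE) aE /X /der (euler_homog l1).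
  by exists (a + c * a); ring.
Qed.

End Derivations.

(** * Deleting a line *)

Section Deletion.
Variables (K : numFieldType) (f l : {mpoly K[3]}) (d e1 e2 : nat).
Notation T := {mpoly K[3]}.
Variables (u v : 'I_3 -> T).

Definition spans (g : T) (s t : 'I_3 -> T) :=
  forall w, der w g = 0 -> exists a b, forall i, w i = a * s i + b * t i.

Definition independent (s t : 'I_3 -> T) :=
  forall a b, (forall i, a * s i + b * t i = 0) -> a = 0 /\ b = 0.

Hypotheses (fd : f \is d.-homog) (d_gt0 : (0 < d)%N) (f0 : f != 0).
Hypotheses (sf : squarefree f) (l0 : l != 0) (l1 : l \is 1.-homog).
Hypothesis nlf : ~ divides l f.
Hypotheses (ue : homog_vec e1 u) (ve : homog_vec e2 v).
Hypotheses (ufl : der u (f * l) = 0) (vfl : der v (f * l) = 0).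
Hypothesis span_uv : spans (f * l) u v.

Lemma product_homog : f * l \is d.+1.-homog.
Proof. by rewrite -[d.+1]addn1; apply: dhomogM. Qed.

Lemma product_neq0 : f * l != 0.
Proof. by rewrite mulf_neq0. Qed.

(** Hilbert-Burch form of freeness: the maximal minors of the syzygy matrix recover the gradient up
    to a unit. Squarefreeness of [f * l] makes this gradient primitive. *)
Lemma cross_uv : exists2 h, divides h 1 &
  forall i, cross u v i = h * mderiv i (f * l).
Proof.
have [k dk] := gradient_neq0 product_homog (ltn0Sn d) product_neq0.
apply: cross_generators dk _ ufl vfl span_uv; first exact: factorial_mpoly.
apply: primitive_gradient product_homog (ltn0Sn d) _.
by apply: squarefreeM_prime => //; apply: prime_linear.
Qed.

(** Degrees are compared in [cross_uv]: the minors have degree e1 + e2, the partial derivatives of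
    [f * l] have degree d, and h is constant. *)
Lemma exponents_sum : (e1 + e2)%N = d.
Proof.
have [h h1 uvE] := cross_uv.
have [k dk] := gradient_neq0 product_homog (ltn0Sn d) product_neq0.
have hk : h * mderiv k (f * l) \is (e1 + e2).-homog.
  rewrite -uvE; move: {uvE dk} k.
  by apply: ord3P; rewrite /cross /vec3 /=; apply: rpredB;
    apply: dhomogM || (rewrite addnC; apply: dhomogM).
have hk0 : h * mderiv k (f * l) != 0 by rewrite mulf_neq0 // unit_neq0.
have [i hi [j dj ->]] := homog_factor hk0 hk.
have h0 : h \is 0.-homog.
  have /eqP/msize_poly1P[c _ ->] := msize_unit h1.
  by rewrite -[c%:MP]mulr1 mul_mpolyC; apply: dhomogZ; apply: dhomog1.
rewrite (dhomog_uniq (unit_neq0 h1) hi h0) add0n.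
exact: dhomog_uniq dk dj (mderiv_homog k product_homog).
Qed.

(** Crossing a u + b v = 0 with v and with u gives a and - b times the cross product of u and v,
    which is nonzero. *)
Lemma independent_uv : independent u v.
Proof.
move=> a b ab0; have [h h1 uvE] := cross_uv.
have [k dk] := gradient_neq0 product_homog (ltn0Sn d) product_neq0.
have uv0 : cross u v k != 0 by rewrite uvE mulf_neq0 // unit_neq0.
have zero (c e : T) : c * cross u v k = 0 -> c = 0.
  by move/eqP; rewrite mulf_eq0 (negbTE uv0) orbF => /eqP.
have cross0 (s t : 'I_3 -> T) : (forall i, s i = 0) -> cross s t k = 0.
  by move=> s0; move: {dk uv0 zero} k; apply: ord3P; rewrite /cross /vec3 /= !s0; ring.
split; [have := cross_comb u v a b 0 1 k|have := cross_comb u v a b 1 0 k].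
  by rewrite cross0 // mulr1 mulr0 subr0 => /esym/zero; apply.
rewrite cross0 // mulr1 mulr0 sub0r mulNr => /esym/eqP; rewrite oppr_eq0.
by move/eqP/zero; apply.
Qed.

(** * Syzygies of f tangent to the line, with basis s, t *)

Section Reduced.
Variables (a1 a2 : T) (s t : 'I_3 -> T).
Hypotheses (sE : forall i, s i = u i + a1 * 'X_i).
Hypotheses (tE : forall i, t i = v i + a2 * 'X_i).
Hypotheses (sf0 : der s f = 0) (tf0 : der t f = 0).
Hypotheses (sl : divides l (der s l)) (tl : divides l (der t l)).
Hypotheses (se : homog_vec e1 s) (te : homog_vec e2 t).

Lemma der_euler g k : g \is k.-homog -> der (fun i => 'X_i : T) g = k%:R * g.
Proof. exact: euler_homog. Qed.

(** If w(l) = b l, then subtracting b/(d+1) times the Euler derivation turns w into a syzygy of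
    [f * l], which expands in u and v. *)
Lemma span_st w : der w f = 0 -> divides l (der w l) ->
  exists a b, forall i, w i = a * s i + b * t i.
Proof.
move=> wf [b bE].
pose c : T := (d.+1%:R^-1)%:MP.
have cd : c * d.+1%:R = 1.
  rewrite mulr_natr -scaler_nat -mul_mpolyC mulrC -mpolyCM mulVf ?mpolyC1 //.
  by rewrite pnatr_eq0.
have wE i : w i - c * b * 'X_i = 1 * w i + (- (c * b)) * 'X_i by ring.
have [|a [a' aE]] := span_uv (w := fun i => w i - c * b * 'X_i).
  rewrite (der_comb _ wE) (der_euler product_homog) derM wf bE.
  by rewrite (_ : _ + _ = (1 - c * d.+1%:R) * (f * (b * l)));
    [rewrite cd subrr mul0r|ring].
(* z gathers the Euler terms left after passing from u, v to s, t. Applying both sides to f leaves z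
   d f = 0. *)
exists a, a'; pose z := c * b - a * a1 - a' * a2.
have wE' i : w i = (a * s i + a' * t i) + z * 'X_i.
  by rewrite -[w i](subrK (c * b * 'X_i)) aE sE tE /z; ring.
have wE1 i : w i = 1 * (a * s i + a' * t i) + z * 'X_i by rewrite mul1r.
suff z0 : z = 0 by move=> i; rewrite wE' z0 mul0r addr0.
have := der_comb f wE1; rewrite wf (der_euler fd).
rewrite (der_comb (w := fun i => a * s i + a' * t i) (a := a) (b := a') f (fun i => erefl)).
rewrite sf0 tf0 !mulr0 addr0 mulr0 add0r => /esym/eqP.
rewrite !mulf_eq0 (negbTE f0) orbF natr_mpoly_eq0 => /orP[/eqP//|].
by move=> /eqP dE; move: d_gt0; rewrite dE.
Qed.

(** A relation between s and t makes a u + b v a multiple of the Euler derivation; applied to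
    [f * l], it shows that this multiple is zero. *)
Lemma independent_st : independent s t.
Proof.
move=> a b ab0; pose z := a * a1 + b * a2.
have E i : a * u i + b * v i = 0 * u i + (- z) * 'X_i.
  by rewrite -[LHS]addr0 -(subrr (z * 'X_i)) -[RHS]addr0 -(ab0 i) sE tE /z; ring.
have := der_comb (f * l) E.
rewrite (der_comb (w := fun i => a * u i + b * v i) (a := a) (b := b) _ (fun i => erefl)).
rewrite ufl vfl (der_euler product_homog) !mulr0 addr0 add0r => /esym/eqP.
rewrite !mulf_eq0 oppr_eq0 (negbTE f0) (negbTE l0) !orbF natr_mpoly_eq0.
rewrite orbF => /eqP z0.
by apply: independent_uv => i; rewrite E z0; ring.
Qed.

(* phi is a graded retraction of S with kernel (l). *)
Section Reduction.
Variable phi : {rmorphism T -> T}.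
Hypotheses (phiC : forall c, phi c%:MP = c%:MP).
Hypotheses (phiB : forall p, divides l (p - phi p)) (phil : phi l = 0).
Hypothesis phi_homog : forall p k, p \is k.-homog -> phi p \is k.-homog.

Lemma phi_eq0 p : phi p = 0 <-> divides l p.
Proof.
split=> [p0|[c ->]]; last by rewrite rmorphM phil mulr0.
by have := phiB p; rewrite p0 subr0.
Qed.

Lemma phiK p : phi (phi p) = phi p.
Proof. by have /phi_eq0/eqP := phiB p; rewrite rmorphB subr_eq0 => /eqP. Qed.

(** On the line, s and t are orthogonal to the gradients of f and of l. A nonzero cross product
    would make these gradients parallel, and Euler's relation would then force l to divide f. *)
Lemma phi_parallel i j : phi (s i) * phi (t j) = phi (s j) * phi (t i).
Proof.
pose s' i := phi (s i); pose t' i := phi (t i).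
pose A i := phi (mderiv i f); pose c i := mderiv i l.
have phic k : phi (c k) = c k by rewrite /c (homog0C (mderiv_homog k l1)) phiC.
have dA w : der w f = 0 -> \sum_i phi (w i) * A i = 0.
  move=> /(congr1 phi); rewrite rmorph0 rmorph_sum => E; rewrite -[RHS]E.
  by apply: eq_bigr => k _; rewrite rmorphM.
have dc w : divides l (der w l) -> \sum_i phi (w i) * c i = 0.
  move=> /phi_eq0; rewrite rmorph_sum => E; rewrite -[RHS]E.
  by apply: eq_bigr => k _; rewrite rmorphM phic.
have wA := cross_orthogonal (dA s sf0) (dA t tf0).
have wc := cross_orthogonal (dc s sl) (dc t tl).
apply: (cross_eq0 (u := s') (v := t')) => {i j} k.
apply: NNPP => /eqP wk0; apply: nlf; apply/phi_eq0.
have Ac i j : A i * c j = A j * c i.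
  apply: (mulfI wk0).
  have wA' := wA : forall i j, cross s' t' i * A j = cross s' t' j * A i.
  have wc' := wc : forall i j, cross s' t' i * c j = cross s' t' j * c i.
  by rewrite !mulrA (wA' k i) (wA' k j) mulrAC (wc' i j) mulrAC.
have [k0 ck0] := gradient_neq0 l1 (ltn0Sn 0) l0.
have E : d%:R * phi f * c k0 = 0.
  rewrite -[d%:R](rmorph_nat phi) -rmorphM -(euler_homog fd) rmorph_sum mulr_suml.
  transitivity (A k0 * phi (\sum_i 'X_i * mderiv i l)).
    rewrite rmorph_sum mulr_sumr; apply: eq_bigr => i _.
    by rewrite !rmorphM -/(A i) -/(c i) phic -mulrA Ac; ring.
  by rewrite (euler_homog l1) mul1r phil mulr0.
move/eqP: E; rewrite !mulf_eq0 (negbTE ck0) orbF natr_mpoly_eq0 => /orP[|/eqP//].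
by move=> /eqP dE; move: d_gt0; rewrite dE.
Qed.

Definition free_syzygies := exists k1 k2 p q,
  [/\ homog_vec k1 p /\ homog_vec k2 q, der p f = 0, der q f = 0, spans f p q
    & independent p q].

(** Evaluation at the origin reads off constant terms; their vanishing in every relation encodes
    minimality. The inequalities place e3 last among the exponents. *)
Definition three_syzygies := exists e3 r,
  [/\ (e1 <= e3)%N /\ (e2 <= e3)%N, homog_vec e3 r, der r f = 0,
      forall w, der w f = 0 ->
        exists a b c, forall i, w i = a * s i + b * t i + c * r i
    & forall a b c, (forall i, a * s i + b * t i + c * r i = 0) ->
        [/\ a.@[fun=> 0] = 0, b.@[fun=> 0] = 0 & c.@[fun=> 0] = 0]].

Lemma der_cancel w w' (p q : T) : (forall i, w' i * l = p * s i + q * t i) ->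
  (forall i, w i = w' i) -> der w f = 0.
Proof.
move=> lw ww'; have lwE i : w i * l = p * s i + q * t i by rewrite ww' lw.
(* The zero summand lets [der_comb] apply to a multiple of a single vector. *)
have wE i : w i * l = l * w i + 0 * w i by ring.
apply: (mulfI l0); have := der_comb f wE; rewrite (der_comb f lwE) sf0 tf0.
by rewrite mul0r !mulr0 !addr0.
Qed.

Lemma span_mul_l w : der w f = 0 ->
  exists a b, forall i, w i * l = a * s i + b * t i.
Proof.
move=> wf; have wE i : w i * l = l * w i + 0 * w i by ring.
apply: span_st; first by rewrite (der_comb f wE) wf mulr0 mul0r addr0.
by exists (der w l); rewrite (der_comb l wE); ring.
Qed.

(** For k = 0 the polynomial p must vanish, so the truncated predecessor does no harm. *)
Lemma homog_divl (p : T) k : p * l \is k.-homog -> p \is k.-1.-homog.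
Proof.
have [->|p0] := eqVneq p 0; first by rewrite rpred0.
have pl0 : p * l != 0 by rewrite mulf_neq0.
move=> /(homog_factor pl0)[m pm [j lj ->]].
by rewrite (dhomog_uniq l0 lj l1) addn1.
Qed.

(** For a syzygy w of f, l w is a combination of s and t; dividing by l expresses w through s/l and
    t/l. *)
Lemma free_of_divisible : (forall i, divides l (s i)) ->
  (forall i, divides l (t i)) -> free_syzygies.
Proof.
move=> /fin_all_exists[s' s'E] /fin_all_exists[t' t'E].
exists e1.-1, e2.-1, s', t'; split.
- by split=> i; apply: homog_divl; rewrite -?s'E -?t'E.
- by apply: (@der_cancel _ s' 1 0) => // i; rewrite -s'E; ring.
- by apply: (@der_cancel _ t' 0 1) => // i; rewrite -t'E; ring.
- move=> w /span_mul_l[a [b wE]]; exists a, b => i.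
  by apply: (mulIf l0); rewrite wE s'E t'E; ring.
- move=> a b ab0; apply: independent_st => i.
  by rewrite s'E t'E !mulrA -mulrDl ab0 mul0r.
Qed.

(* P and Q are the coprime parts of phi (s j0) and phi (t j0); by
   [phi_parallel], Q s - P t vanishes on the line, so r = (Q s - P t) / l is a
   third syzygy of f, and its class generates D_0(f) modulo s and t. *)
Section Quotient.
Variables (j0 : 'I_3) (g P Q : T) (r : 'I_3 -> T).
Hypotheses (sE0 : phi (s j0) = g * P) (tE0 : phi (t j0) = g * Q).
Hypotheses (g0 : g != 0) (PQ0 : (P != 0) || (Q != 0)).
Hypothesis PQ_coprime : forall p, prime_elt p -> divides p P -> ~ divides p Q.
Hypothesis rE : forall i, r i * l = Q * s i - P * t i.

Lemma r_mul_l i : r i * l = Q * s i + (- P) * t i.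
Proof. by rewrite rE; ring. Qed.

Lemma coprime_parallel a b : a * P = - (b * Q) ->
  exists h, a = h * Q /\ b = - (h * P).
Proof.
(* The pair (- b, a) is parallel to the primitive pair (P, Q), hence a multiple of it. *)
move=> ab; pose G (x : bool) := if x then P else Q.
pose W (x : bool) := if x then - b else a.
have [x0 Gx0] : exists x, G x != 0.
  by case/orP: PQ0 => ?; [exists true|exists false].
have [||h hE] := primitive_parallel (w := W) (@factorial_mpoly K 3) Gx0.
- move=> p pp; apply: NNPP => np; apply: (PQ_coprime pp); apply: NNPP => npi.
    by apply: np; exists true.
  by apply: np; exists false.
- by case; case; rewrite /= ?ab ?mulNr //; ring.
exists h; split; first exact: (hE false).
by rewrite -[h * P](hE true) opprK.
Qed.

(** Write l w = a s + b t. Restricting entry j0 to the line and cancelling g gives a = h Q and b = -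
    h P modulo l, so l w is h l r plus l times a combination of s and t. *)
Lemma span_str w : der w f = 0 ->
  exists a b c, forall i, w i = a * s i + b * t i + c * r i.
Proof.
move=> /span_mul_l[a [b wE]].
have [|h [ah bh]] := @coprime_parallel (phi a) (phi b).
  apply: (mulfI g0); apply/eqP; rewrite mulrN -subr_eq0 opprK.
  have := congr1 phi (wE j0); rewrite rmorphM phil mulr0 rmorphD !rmorphM sE0 tE0.
  by move=> E; apply/eqP; rewrite [RHS]E; ring.
have [x xE] := phiB a; have [y yE] := phiB b.
exists x, y, h => i; apply: (mulIf l0); rewrite wE.
have -> : a = x * l + h * Q by rewrite -xE ah; ring.
have -> : b = y * l - h * P by rewrite -yE bh; ring.
by rewrite [RHS]mulrDl -[h * r i * l]mulrA rE; ring.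
Qed.

Lemma der_r : der r f = 0.
Proof. exact: der_cancel r_mul_l _. Qed.

Lemma homog_r k : (forall i, Q * s i - P * t i \is k.-homog) -> homog_vec k.-1 r.
Proof. by move=> k_homog i; apply: homog_divl; rewrite rE. Qed.

Lemma homog_P : P != 0 -> exists m k,
  [/\ g \is m.-homog, P \is k.-homog & e1 = (m + k)%N].
Proof.
move=> P0; have gP0 : g * P != 0 by rewrite mulf_neq0.
have : g * P \is e1.-homog by rewrite -sE0; apply: phi_homog.
by move=> /(homog_factor gP0)[m gm [k Pk E]]; exists m, k.
Qed.

Lemma homog_Q : Q != 0 -> exists m k,
  [/\ g \is m.-homog, Q \is k.-homog & e2 = (m + k)%N].
Proof.
move=> Q0; have gQ0 : g * Q != 0 by rewrite mulf_neq0.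
have : g * Q \is e2.-homog by rewrite -tE0; apply: phi_homog.
by move=> /(homog_factor gQ0)[m gm [k Qk E]]; exists m, k.
Qed.

(** With m the degree of g, both Q s and P t have degree m + k1 + k2; division by l lowers it by
    one. *)
Lemma homog_PQ : P != 0 -> Q != 0 -> exists m k1 k2,
  [/\ P \is k1.-homog, Q \is k2.-homog, e1 = (m + k1)%N, e2 = (m + k2)%N
    & homog_vec (m + k1 + k2).-1 r].
Proof.
move=> /homog_P[m [k1 [gm Pk E1]]] /homog_Q[m' [k2 [gm' Qk E2]]].
have mE := dhomog_uniq g0 gm' gm; rewrite mE in E2.
exists m, k1, k2; split=> //; apply: homog_r => i; apply: rpredB.
  by rewrite -E1 addnC; apply: dhomogM.
by rewrite -addnA addnCA -E2; apply: dhomogM.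
Qed.

Lemma exists_homog_r : exists k, homog_vec k r.
Proof.
have [P0|P0] := eqVneq P 0.
  have Q0 : Q != 0 by move: PQ0; rewrite P0 eqxx.
  have [m [k [_ Qk _]]] := homog_Q Q0.
  exists (k + e1).-1; apply: homog_r => i.
  by rewrite P0 mul0r subr0; apply: dhomogM.
have [Q0|Q0] := eqVneq Q 0.
  have [m [k [_ Pk _]]] := homog_P P0.
  exists (k + e2).-1; apply: homog_r => i.
  by rewrite Q0 mul0r sub0r rpredN; apply: dhomogM.
by have [m [k1 [k2 [_ _ _ _ rk]]]] := homog_PQ P0 Q0; exists (m + k1 + k2).-1.
Qed.

(** If c P = 1, then t = c (Q s - l r), so r and s generate. Multiplying a relation between them by
    l gives one between s and t. *)
Lemma free_of_unitP : divides P 1 -> free_syzygies.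
Proof.
move=> P1; have P0 := unit_neq0 P1; have [c cP] := P1.
have [k rk] := exists_homog_r; exists k, e1, r, s; split=> //; first exact: der_r.
  move=> w /span_str[a [b [x wE]]].
  exists (x - b * c * l), (a + b * c * Q) => i.
  have tiE : t i = c * (Q * s i - r i * l).
    by rewrite rE -[LHS]mul1r cP; ring.
  by rewrite wE tiE; ring.
move=> a b ab0; have [|E1 E2] := @independent_st (a * Q + b * l) (- (a * P)).
  move=> i; transitivity ((a * r i + b * s i) * l); last by rewrite ab0 mul0r.
  by rewrite [RHS]mulrDl -[a * r i * l]mulrA rE; ring.
have a0 : a = 0.
  by move/eqP: E2; rewrite oppr_eq0 mulf_eq0 (negbTE P0) orbF => /eqP.
split=> //; move/eqP: E1.
by rewrite a0 mul0r add0r mulf_eq0 (negbTE l0) orbF => /eqP.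
Qed.

Lemma free_of_unitQ : divides Q 1 -> free_syzygies.
Proof.
move=> Q1; have Q0 := unit_neq0 Q1; have [c cQ] := Q1.
have [k rk] := exists_homog_r; exists k, e2, r, t; split=> //; first exact: der_r.
  move=> w /span_str[a [b [x wE]]].
  exists (x + a * c * l), (b + a * c * P) => i.
  have siE : s i = c * (P * t i + r i * l).
    by rewrite rE -[LHS]mul1r cQ; ring.
  by rewrite wE siE; ring.
move=> a b ab0; have [|E1 E2] := @independent_st (a * Q) (b * l - a * P).
  move=> i; transitivity ((a * r i + b * t i) * l); last by rewrite ab0 mul0r.
  by rewrite [RHS]mulrDl -[a * r i * l]mulrA rE; ring.
have a0 : a = 0.
  by move/eqP: E1; rewrite mulf_eq0 (negbTE Q0) orbF => /eqP.
split=> //; move/eqP: E2.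
by rewrite a0 mul0r subr0 mulf_eq0 (negbTE l0) orbF => /eqP.
Qed.

Lemma nonunit_neq0 : ~ divides P 1 -> ~ divides Q 1 -> P != 0 /\ Q != 0.
Proof.
move=> nP nQ; split; apply/eqP => z0.
  have Q0 : Q != 0 by move: PQ0; rewrite z0 eqxx.
  have [p pp pQ] := exists_prime_divisor (@factorial_mpoly K 3) Q0 nQ.
  by apply: (PQ_coprime pp) pQ; rewrite z0; apply: divides0.
have P0 : P != 0 by move: PQ0; rewrite z0 eqxx orbF.
have [p pp pP] := exists_prime_divisor (@factorial_mpoly K 3) P0 nP.
by apply: (PQ_coprime pp) pP _; rewrite z0; apply: divides0.
Qed.

(** [phi] is idempotent, so it fixes g P even where it moves g or P; thus a nonzero P has nonzero
    restriction to the line. *)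
Lemma phi_gP : phi g * phi P = g * P.
Proof. by rewrite -rmorphM -sE0 phiK. Qed.

Lemma phi_gQ : phi g * phi Q = g * Q.
Proof. by rewrite -rmorphM -tE0 phiK. Qed.

(** Multiplied by l, a relation a s + b t + c r = 0 gives a l = - c Q and b l = c P. Restriction to
    the line forces c = x l, hence a = - x Q and b = x P, where P, Q and l have positive degree. *)
Lemma three_of_nonunit : ~ divides P 1 -> ~ divides Q 1 -> three_syzygies.
Proof.
move=> nP nQ; have [P0 Q0] := nonunit_neq0 nP nQ.
have [m [k1 [k2 [Pk Qk E1 E2 rk]]]] := homog_PQ P0 Q0.
have k1_gt0 : (0 < k1)%N.
  by rewrite lt0n; apply/eqP => z; apply: nP; rewrite z in Pk; apply: homog0_unit Pk.
have k2_gt0 : (0 < k2)%N.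
  by rewrite lt0n; apply/eqP => z; apply: nQ; rewrite z in Qk; apply: homog0_unit Qk.
(* Since k1 and k2 are at least 1, the degree of r is at least m + k1 = e1 and m + k2 = e2. *)
exists (m + k1 + k2).-1, r; split=> //; first by split; lia.
- exact: der_r.
- exact: span_str.
move=> a b c abc0.
have [|Ea Eb] := @independent_st (a * l + c * Q) (b * l - c * P).
  move=> i; transitivity ((a * s i + b * t i + c * r i) * l).
    by rewrite [RHS]mulrDl -[c * r i * l]mulrA rE; ring.
  by rewrite abc0 mul0r.
have [x cE] : divides l c.
  apply/phi_eq0; have /(congr1 phi) := Ea; have /(congr1 phi) := Eb.
  rewrite rmorphB rmorphD !rmorphM phil !mulr0 !add0r rmorph0.
  move/eqP; rewrite oppr_eq0 mulf_eq0 => /orP[/eqP //|/eqP P'0].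
  move/eqP; rewrite mulf_eq0 => /orP[/eqP //|/eqP Q'0].
  have := phi_gP; have := phi_gQ; rewrite P'0 Q'0 mulr0 => /esym/eqP.
  by rewrite mulf_eq0 (negbTE g0) (negbTE Q0).
have aE : a = - (x * Q).
  by apply: (mulIf l0); apply/eqP; rewrite -subr_eq0 -[X in _ == X]Ea cE; apply/eqP; ring.
have bE : b = x * P.
  by apply: (mulIf l0); apply/eqP; rewrite -subr_eq0 -[X in _ == X]Eb cE; apply/eqP; ring.
rewrite aE bE cE mevalN !mevalM (meval_homog k1_gt0 Pk) (meval_homog k2_gt0 Qk).
by rewrite (meval_homog (ltn0Sn 0) l1) !mulr0 oppr0.
Qed.

Lemma quotient_cases : free_syzygies \/ three_syzygies.
Proof.
have [P1|nP] := classic (divides P 1); first by left; apply: free_of_unitP.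
have [Q1|nQ] := classic (divides Q 1); first by left; apply: free_of_unitQ.
by right; apply: three_of_nonunit.
Qed.

End Quotient.

Lemma syzygy_cases : free_syzygies \/ three_syzygies.
Proof.
have [[j0 st0]|st0] := classic (exists j, phi (s j) <> 0 \/ phi (t j) <> 0); last first.
  left; apply: free_of_divisible => i; apply/phi_eq0; apply: NNPP => ni; apply: st0.
    by exists i; left.
  by exists i; right.
pose F (x : bool) := phi (if x then s j0 else t j0).
have [x0 Fx0] : exists x, F x != 0.
  by case: st0 => /eqP ?; [exists true|exists false].
have [g [G [FG pG]]] := gcd_family (@factorial_mpoly K 3) Fx0.
have g0 : g != 0 by apply: contraNneq Fx0 => g0; rewrite FG g0 mul0r.
have Gx0 : G x0 != 0 by apply: contraNneq Fx0 => z; rewrite FG z mulr0.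
(* Parallelism carries the relation from entry j0 to every entry. It is proved for the restrictions
   first, since [phi] may move G. *)
have rdiv i : divides l (G false * s i - G true * t i).
  apply/phi_eq0; rewrite rmorphB !rmorphM.
  rewrite -[phi (s i)]phiK -[phi (t i)]phiK -!rmorphM -rmorphB.
  suff -> : G false * phi (s i) - G true * phi (t i) = 0 by rewrite rmorph0.
  apply: (mulfI g0); rewrite mulr0 mulrBr !mulrA -(FG true) -(FG false) /F.
  by rewrite [X in X - _]mulrC phi_parallel subrr.
have [r rE] := fin_all_exists rdiv.
apply: (@quotient_cases j0 g (G true) (G false) r) => //.
- exact: (FG true).
- exact: (FG false).
- by case: x0 {Fx0} Gx0 => ->; rewrite ?orbT.
- move=> p pp pP pQ; have [x nx] := pG p pp; apply: nx.
  by case: x.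
Qed.

End Reduction.
End Reduced.
End Deletion.

(** * Minimal generators *)

Definition vec (x : S * S * S) : 'I_3 -> S := vec3 x.1.1 x.1.2 x.2.

Definition triple (v : 'I_3 -> S) : S * S * S := (v ix, v iy, v iz).

Definition gen (gens : seq (nat * (S * S * S))) j : 'I_3 -> S :=
  vec (nth (0%N, (0, 0, 0)) gens j).2.

Lemma vec_triple v : vec (triple v) =1 v.
Proof. exact: ord3P. Qed.

Lemma eq_der (u v : 'I_3 -> S) f : u =1 v -> der u f = der v f.
Proof. by move=> uv; apply: eq_bigr => i _; rewrite uv. Qed.

Lemma jac_syzE f x : jac_syz f x <-> der (vec x) f = 0.
Proof. by rewrite /jac_syz /der sum3. Qed.

Lemma hom_syz_triple f k v : homog_vec k v -> der v f = 0 ->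
  hom_syz f (k, triple v).
Proof.
move=> vk vf; split; rewrite /= ?vk //; apply/jac_syzE.
by rewrite (eq_der _ (vec_triple v)).
Qed.

Lemma hom_syzP f k x : hom_syz f (k, x) -> homog_vec k (vec x) /\ der (vec x) f = 0.
Proof. by case=> xk yk zk /jac_syzE; split=> //; apply: ord3P. Qed.

Lemma generatesP f gens : generates f gens ->
  (forall j, (j < size gens)%N -> der (gen gens j) f = 0) /\
  forall w, der w f = 0 -> exists C : 'I_(size gens) -> S,
    forall i, w i = \sum_(j < size gens) C j * gen gens j i.
Proof.
move=> [hom span]; split=> [j jn|w wf].
  have := hom _ (mem_nth (0%N, (0, 0, 0)) jn).
  by rewrite /gen; case: nth => k x /hom_syzP[].
have [|cs [scs [Ex Ey Ez]]] := span (triple w).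
  by apply/jac_syzE; rewrite (eq_der _ (vec_triple w)).
by exists (fun j => cs`_j); apply: ord3P.
Qed.

Lemma generates_of f (gens : seq (nat * (S * S * S))) :
  (forall ks, ks \in gens -> hom_syz f ks) ->
  (forall w, der w f = 0 -> exists C : 'I_(size gens) -> S,
    forall i, w i = \sum_(j < size gens) C j * gen gens j i) ->
  generates f gens.
Proof.
move=> hom span; split=> // x /jac_syzE/span[C CE].
exists [tuple C j | j < size gens]; rewrite size_tuple; split=> //.
by split; [rewrite [LHS](CE ix)|rewrite [LHS](CE iy)|rewrite [LHS](CE iz)];
  apply: eq_bigr => j _; rewrite -tnth_nth tnth_mktuple.
Qed.

(* Modulo the ideal of the origin the generators of gens are linearly
   independent, which is what relations without constant term mean. *)
Lemma minimal_of_relations f gens : generates f gens ->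
  (forall C : 'I_(size gens) -> S,
    (forall i, \sum_(j < size gens) C j * gen gens j i = 0) ->
    forall j, (C j).@[fun=> 0] = 0) ->
  minimal_generators f gens.
Proof.
move=> ggens rel; split=> // gens' ggens'.
have [gf gspan] := generatesP ggens; have [g'f g'span] := generatesP ggens'.
have [A AE] := fin_all_exists (fun j : 'I_(size gens) =>
  g'span _ (gf j (ltn_ord j))).
have [B BE] := fin_all_exists (fun j : 'I_(size gens') =>
  gspan _ (g'f j (ltn_ord j))).
pose ev (p : S) := p.@[fun=> 0].
apply: (@mulmx1_min CC _ _ (\matrix_(j, k) ev (A j k)) (\matrix_(k, j) ev (B k j))).
apply/matrixP => j j'; rewrite !mxE; apply/eqP; rewrite -subr_eq0; apply/eqP.
(* Row j of A B - 1 is a relation among [gens], so A B = 1 at the origin; this bounds the number of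
   rows of A by its number of columns. *)
pose C j' : S := \sum_k A j k * B k j' - (j == j')%:R.
apply: etrans (rel C _ j').
  rewrite /C mevalB rmorph_sum /= rmorph_nat.
  by congr (_ - _); apply: eq_bigr => k _; rewrite !mxE mevalM.
move=> i; under eq_bigr do rewrite mulrBl.
rewrite sumrB [X in _ - X](bigD1 j) //= eqxx mul1r [X in _ - (_ + X)]big1.
  rewrite addr0 AE; apply/eqP; rewrite subr_eq0; apply/eqP.
  under eq_bigr do rewrite mulr_suml.
  rewrite exchange_big; apply: eq_bigr => k _ /=; rewrite BE mulr_sumr.
  by apply: eq_bigr => m _; rewrite mulrA.
by move=> k; rewrite eq_sym => /negbTE->; rewrite mul0r.
Qed.

Lemma free_curve_of f k1 k2 (p q : 'I_3 -> S) :
  homog_vec k1 p -> homog_vec k2 q -> der p f = 0 -> der q f = 0 ->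
  spans f p q -> independent p q -> free_curve f.
Proof.
wlog k12 : k1 k2 p q / (k1 <= k2)%N.
  have [k12|/ltnW k21] := leqP k1 k2; first by apply.
  move=> wl pk qk pf qf span ind; apply: (wl k2 k1 q p) => //.
    by move=> w /span[a [b wE]]; exists b, a => i; rewrite wE addrC.
  by move=> a b ab0; have [|] := ind b a; first by move=> i; rewrite addrC.
move=> pk qk pf qf span ind.
exists [:: k1; k2]; split=> //; exists [:: (k1, triple p); (k2, triple q)].
split; last by rewrite /= k12.
apply: minimal_of_relations.
  apply: generates_of => [ks|w /span[a [b wE]]].
    by rewrite !inE => /orP[]/eqP->; apply: hom_syz_triple.
  exists (fun j => if val j == 0%N then a else b) => i.
  by rewrite !big_ord_recl big_ord0 addr0 /gen /= !vec_triple wE.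
move=> C C0; have [|C00 C01] := ind (C ord0) (C (lift ord0 ord0)).
  move=> i; have := C0 i.
  by rewrite !big_ord_recl big_ord0 addr0 /gen /= !vec_triple.
move=> j; case: (unliftP ord0 j) => [k|] ->; last by rewrite C00 meval0.
by rewrite ord1 C01 meval0.
Qed.

Lemma exponents3_of f e1 e2 e3 (s t r : 'I_3 -> S) :
  (e1 <= e2)%N -> (e2 <= e3)%N ->
  homog_vec e1 s -> homog_vec e2 t -> homog_vec e3 r ->
  der s f = 0 -> der t f = 0 -> der r f = 0 ->
  (forall w, der w f = 0 ->
    exists a b c, forall i, w i = a * s i + b * t i + c * r i) ->
  (forall a b c, (forall i, a * s i + b * t i + c * r i = 0) ->
    [/\ a.@[fun=> 0] = 0, b.@[fun=> 0] = 0 & c.@[fun=> 0] = 0]) ->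
  exponents f [:: e1; e2; e3].
Proof.
move=> e12 e23 se te re sf tf rf span rel.
exists [:: (e1, triple s); (e2, triple t); (e3, triple r)].
split; last by rewrite /= e12 e23.
apply: minimal_of_relations.
  apply: generates_of => [ks|w /span[a [b [c wE]]]].
    by rewrite !inE => /or3P[]/eqP->; apply: hom_syz_triple.
  exists (fun j => if val j == 0%N then a else if val j == 1%N then b else c) => i.
  by rewrite !big_ord_recl big_ord0 addr0 /gen /= !vec_triple wE addrA.
pose j1 : 'I_3 := lift ord0 ord0; pose j2 : 'I_3 := lift ord0 (lift ord0 ord0).
move=> C C0; have [|C00 C01 C02] := rel (C ord0) (C j1) (C j2).
  move=> i; have := C0 i.
  by rewrite !big_ord_recl big_ord0 addr0 /gen /= !vec_triple addrA.
move=> j; case: (unliftP ord0 j) => [k|] -> //.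
case: (unliftP ord0 k) => [k'|] -> //.
by rewrite ord1.
Qed.

Lemma free_curve_generators F : free_curve F ->
  exists e1 e2 u v, [/\ (e1 <= e2)%N, homog_vec e1 u /\ homog_vec e2 v,
    der u F = 0, der v F = 0 & spans F u v].
Proof.
move=> [ds [[gens [[ggens _] [<- srt]]]]].
case: gens ggens srt => [|[e1 x] [|[e2 y] [|]]] //= ggens /andP[e12 _] _.
have [uk uF] : homog_vec e1 (vec x) /\ der (vec x) F = 0.
  by apply: hom_syzP; apply: ggens.1; rewrite !inE eqxx.
have [vk vF] : homog_vec e2 (vec y) /\ der (vec y) F = 0.
  by apply: hom_syzP; apply: ggens.1; rewrite !inE eqxx orbT.
exists e1, e2, (vec x), (vec y); split=> // w.
have [_ span] := generatesP ggens; move=> /span[C wE].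
exists (C ord0), (C (lift ord0 ord0)) => i.
by rewrite wE !big_ord_recl big_ord0 addr0.
Qed.

Lemma squarefree_of_reduced f : reduced f -> squarefree f.
Proof.
move=> [f0 red] p [p0 pn1 _] [c E]; apply: pn1; apply: msize1_unit => //.
by apply: (red p c); rewrite E mulrC.
Qed.

Theorem theorem1p1 (f l : S) (d : nat) :
  homog_of_deg f d -> (3 <= d)%N -> reduced f ->
  homog_of_deg l 1 ->
  ~ (exists q : S, f = l * q) ->
  free_curve (f * l) ->
  free_curve f \/ plus_one_generated f d.
Proof.
move=> [f0 fd] d3 /squarefree_of_reduced sf [l0 l1] nlf.
have {d3} d0 : (0 < d)%N by apply: leq_trans d3.
have {}nlf : ~ divides l f by move=> [q fE]; apply: nlf; exists q; rewrite mulrC.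
move=> /free_curve_generators[e1 [e2 [u [v [e12 [ue ve] uF vF span]]]]].
have [a1 [s [sE se sf0 sl]]] := syzygy_of_product fd d0 l0 l1 nlf ue uF.
have [a2 [t [tE te tf0 tl]]] := syzygy_of_product fd d0 l0 l1 nlf ve vF.
have [phi [phiC phiB phil phi_homog]] := linear_reduction l0 l1.
have dE := exponents_sum fd f0 sf l0 l1 nlf ue ve uF vF span.
have [] := syzygy_cases fd d0 f0 sf l0 l1 nlf uF vF span sE tE sf0 tf0 sl tl
  se te phiC phiB phil phi_homog.
  move=> [k1 [k2 [p [q [[pk qk] pf qf spanf ind]]]]]; left.
  exact: free_curve_of pk qk pf qf spanf ind.
move=> [e3 [r [[_ e23] re rf spanf rel]]]; right.
(* Here s and t keep the degrees of u and v, so [dE] supplies e1 + e2 = d. *)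
by exists e1, e2, e3; split=> //; apply: exponents3_of e12 e23 se te re _ _ _ spanf rel.
Qed.
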